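(* In the setting below, suppose $0<\eta\le\frac{1}{L(K+1)}$, let $a\ge 2$ be an integer and set $\epsilon_i=2\eta L(\eta KL)^{i-1}$ for $i\ge1$. Then for every integer $k\ge aK+1$, \[ \Big(1+\eta\frac{\mu}{8}\Big)F_{k+1}\le\Big(1-\sum_{i=1}^{a-1}\epsilon_i\Big)F_k+\sum_{i=1}^{a-1}\epsilon_i F_{k-iK}+\eta^2\frac{KL}{2}\epsilon_{a-1}\sum_{j=k-aK}^{k-1}\|d_j\|^2 . \]
   Context: Let $m,n\ge 1$ be integers and $\|\cdot\|$ the Euclidean norm on $\mathbb{R}^n$. For $i=1,\dots,m$, let $f_i:\mathbb{R}^n\to\mathbb{R}$ be continuously differentiable with $\|\nabla f_i(x)-\nabla f_i(y)\|\le L_i\|x-y\|$ for all $x,y$, where $L_i\ge 0$ (the $f_i$ are not assumed convex). Let $f=\frac1m\sum_{i=1}^m f_i$ and $L=\frac1m\sum_{i=1}^m L_i$. Assume $f$ is $\mu$-strongly convex for some $\mu>0$ (i.e. $x\mapsto f(x)-\frac{\mu}{2}\|x\|^2$ is convex). Let $r:\mathbb{R}^n\to(-\infty,\infty]$ be proper, closed and convex, let $F=f+r$, and let $x^*$ be the unique minimizer of $F$. For $\eta>0$ define $\mathrm{prox}_r^\eta(y)=\arg\min_{x\in\mathbb{R}^n}\{\frac12\|x-y\|^2+\eta r(x)\}$. PIAG method: fix an integer $K\ge 0$, a step size $\eta>0$ and $x_0\in\mathbb{R}^n$; for each $k\ge0$ and each $i$ let $\tau_{i,k}$ be any (deterministically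 chosen) integer with $\max(k-K,0)\le\tau_{i,k}\le k$; set $g_k=\frac1m\sum_{i=1}^m\nabla f_i(x_{\tau_{i,k}})$ and $x_{k+1}=\mathrm{prox}_r^\eta(x_k-\eta g_k)$. Define $d_k=(x_{k+1}-x_k)/\eta$ and $F_k=F(x_k)-F(x^* )$. *)

(* Defs.v *)
From HB Require Import structures.
From mathcomp Require Import all_boot all_order all_algebra.
From mathcomp Require Import all_classical all_reals all_analysis.
Set Implicit Arguments. Unset Strict Implicit. Unset Printing Implicit Defensive.
Import Order.TTheory GRing.Theory Num.Theory.
Import numFieldNormedType.Exports.
Local Open Scope ring_scope.

Section Defs.
Variables (R : realType) (n : nat).

Definition dotv (u v : 'rV[R]_n) : R := \sum_(j < n) u 0 j * v 0 j.
Definition enorm (u : 'rV[R]_n) : R := Num.sqrt (dotv u u).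

Definition has_gradient (f : 'rV[R]_n -> R) (g : 'rV[R]_n -> 'rV[R]_n) : Prop :=
  forall x, differentiable f x /\ forall h, ('d f x : 'rV[R]_n -> R) h = dotv (g x) h.

Definition lipschitz_grad (g : 'rV[R]_n -> 'rV[R]_n) (Li : R) : Prop :=
  forall x y, enorm (g x - g y) <= Li * enorm (x - y).

Definition convex_fun (f : 'rV[R]_n -> R) : Prop :=
  forall x y (t : R), 0 <= t <= 1 ->
    f (t *: x + (1 - t) *: y) <= t * f x + (1 - t) * f y.

Definition strongly_convex (f : 'rV[R]_n -> R) (mu : R) : Prop :=
  convex_fun (fun x => f x - mu / 2 * enorm x ^+ 2).

Definition proper_fun (r : 'rV[R]_n -> \bar R) : Prop :=
  (forall x, r x != -oo%E) /\ (exists x, r x != +oo%E).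

Definition closed_fun (r : 'rV[R]_n -> \bar R) : Prop :=
  closed [set p : 'rV[R]_n * R | (r p.1 <= p.2%:E)%E].

Definition convex_efun (r : 'rV[R]_n -> \bar R) : Prop :=
  forall (x y : 'rV[R]_n) (t : R), 0 < t < 1 ->
    (r (t *: x + (1 - t) *: y)%R <= t%:E * r x + (1 - t)%:E * r y)%E.

Definition is_prox (r : 'rV[R]_n -> \bar R) (eta : R) (y p : 'rV[R]_n) : Prop :=
  forall z, ((1/2 * enorm (p - y) ^+ 2)%:E + eta%:E * r p <=
             (1/2 * enorm (z - y) ^+ 2)%:E + eta%:E * r z)%E.

End Defs.

(* Main.v *)
(* Put w_j = |x_{j+1} - x_j| = eta |d_j|. The prox step gives the subgradient
   -(g_k + d_k) of r at x_{k+1}; together with the smoothness of f and the bound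
   |g_k - grad f (x_k)| <= L sum_{k-K <= l < k} w_l this yields
     F_{j+1} <= F_j - w_j^2 / (2 eta) + (L / 2) sum_{j-K <= l < j} w_l^2,
   and strong convexity yields 2 mu F_{k+1} <= |g_k + d_k - grad f (x_{k+1})|^2.
   Combining both, (1 + eta mu / 8) F_{k+1} <= F_k + L S_1, where
   S_i = sum_{k-iK <= l < k} w_l^2. Summing the first inequality over
   k - iK <= j < k gives S_i / (2 eta) <= F_{k-iK} - F_k + (K L / 2) S_{i+1},
   and substituting this for i = 1, ..., a-1 produces the weights eps_i. *)
Require Import Defs.
From HB Require Import structures.
From mathcomp Require Import all_boot all_order all_algebra.
From mathcomp Require Import all_classical all_reals all_analysis.
From mathcomp Require Import ring lra zify.
Import Order.TTheory GRing.Theory Num.Theory.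
Import numFieldNormedType.Exports.
Local Open Scope ring_scope.

(** * Sums over sliding windows *)

(* Each [u l] lies in at most K of the inner windows. *)
Lemma sum_window_le (R : realDomainType) (u : nat -> R) (K p k : nat) :
  (forall j, 0 <= u j) -> (K <= p)%N ->
  \sum_(p <= j < k) \sum_(j - K <= l < j) u l <=
  K%:R * \sum_(p - K <= l < k) u l.
Proof.
move=> u0 Kp.
have -> : \sum_(p <= j < k) \sum_(j - K <= l < j) u l =
    \sum_(p <= j < k) \sum_(s < K) u (s + (j - K))%N.
  apply: eq_big_nat => j /andP[pj _].
  have Kj := leq_trans Kp pj.
  rewrite -{1}[(j - K)%N]add0n big_addn.
  by rewrite (_ : (j - (j - K))%N = K) ?big_mkord// subKn.
rewrite exchange_big/=.
have -> (X : R) : K%:R * X = \sum_(s < K) X by rewrite sumr_const card_ord mulr_natl.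
apply: ler_sum => s _.
have [kp|pk] := leqP k p.
  by rewrite big_geq// sumr_ge0.
(* For a fixed offset [s], moving [j] slides one index along a contiguous range. Since [s < K], that
   range lies inside [[p - K, k)], and the two pieces left over are nonnegative. *)
have -> : \sum_(p <= j < k) u (s + (j - K))%N =
    \sum_(s + (p - K) <= l < s + (k - K)) u l.
  rewrite [RHS](_ : _ = \sum_(0 + (s + (p - K)) <= l < s + (k - K)) u l)//.
  rewrite [LHS](_ : _ = \sum_(0 + p <= l < k) u (s + (l - K))%N)//.
  rewrite !big_addn (_ : (s + (k - K) - (s + (p - K)) = k - p)%N); last by lia.
  by apply: eq_big_nat => j _; congr u; lia.
have sK := ltn_ord s.
rewrite [leRHS](big_cat_nat (n := (s + (p - K))%N))/=; [|lia|lia].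
rewrite [X in _ + X](big_cat_nat (n := (s + (k - K))%N))/=; [|lia|lia].
have := sumr_ge0 (index_iota (p - K) (s + (p - K))) (fun i _ => u0 i) (P := xpredT).
have := sumr_ge0 (index_iota (s + (k - K)) k) (fun i _ => u0 i) (P := xpredT).
lra.
Qed.

(** Cauchy-Schwarz against the constant 1. In the induction, the cross term created by a new entry
    is split termwise with [2ab <= a^2 + b^2]. *)
Lemma sqr_sum_le (R : realDomainType) (u : nat -> R) (p q : nat) :
  (\sum_(p <= j < q) u j) ^+ 2 <= (q - p)%:R * \sum_(p <= j < q) u j ^+ 2.
Proof.
have [qp|pq] := leqP q p; first by rewrite !big_geq ?expr0n ?mulr0.
rewrite -(subnKC (ltnW pq)); move: (q - p)%N => N {pq q}.
rewrite addKn; elim: N => [|N IH].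
  by rewrite !addn0 !big_geq ?expr0n ?mulr0.
rewrite addnS !big_nat_recr ?leq_addr//=.
set S := \sum_(p <= j < p + N) u j in IH *.
set Q := \sum_(p <= j < p + N) u j ^+ 2 in IH *.
have cross : 2 * S * u (p + N)%N <= Q + N%:R * u (p + N)%N ^+ 2.
  have -> : N%:R * u (p + N)%N ^+ 2 = \sum_(p <= j < p + N) u (p + N)%N ^+ 2.
    by rewrite sumr_const_nat addKn mulr_natl.
  rewrite -big_split/= mulrAC mulr_sumr; apply: ler_sum => j _.
  have := sqr_ge0 (u j - u (p + N)%N); lra.
rewrite -natr1; lra.
Qed.

(** Young's inequality termwise; [K] only bounds the number of terms. *)
Lemma sum_mul_le (R : realFieldType) (u : nat -> R) (c : R) (p q K : nat) :
  (q - p <= K)%N ->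
  (\sum_(p <= j < q) u j) * c <=
  2^-1 * (\sum_(p <= j < q) u j ^+ 2 + K%:R * c ^+ 2).
Proof.
move=> qpK.
apply: (@le_trans _ _ (2^-1 * (\sum_(p <= j < q) (u j ^+ 2 + c ^+ 2)))).
  rewrite mulr_suml mulr_sumr; apply: ler_sum => j _.
  have := sqr_ge0 (u j - c); lra.
rewrite big_split/= sumr_const_nat -[_ *+ (q - p)]mulr_natl.
rewrite ler_wpM2l ?invr_ge0// lerD2l ler_wpM2r ?sqr_ge0// ler_nat//.
Qed.

(** * The delayed scalar recursion *)

Section DelayedRecursion.
Context {R : realFieldType}.
Variables (f w : nat -> R) (K : nat) (L eta c : R).
Hypotheses (eta_gt0 : 0 < eta) (L_ge0 : 0 <= L).
Hypothesis descent : forall j, (K < j)%N ->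
  f j.+1 <= f j - w j ^+ 2 / (2 * eta)
            + L / 2 * \sum_(j - K <= l < j) w l ^+ 2.
Let eps i := 2 * eta * L * (eta * K%:R * L) ^+ (i - 1).
Let S k i := \sum_(k - i * K <= l < k) w l ^+ 2.

(** Telescoping [descent] over [k - i * K <= j < k]; the double sum is absorbed by the window one
    step longer. The strict bound on [k] gives [K < j] throughout, as [descent] requires. *)
Lemma window_energy_le k i : (i.+1 * K < k)%N ->
  S k i / (2 * eta) <= f (k - i * K)%N - f k + K%:R * L / 2 * S k i.+1.
Proof.
move=> ik.
have tele : \sum_(k - i * K <= j < k) (f j.+1 - f j) = f k - f (k - i * K)%N.
  by rewrite telescope_sumr// leq_subr.
have le : \sum_(k - i * K <= j < k) (f j.+1 - f j) <=
    \sum_(k - i * K <= j < k) (- (w j ^+ 2 / (2 * eta)) +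
       L / 2 * \sum_(j - K <= l < j) w l ^+ 2).
  rewrite big_nat_cond [leRHS]big_nat_cond.
  apply: ler_sum => j; rewrite andbT => /andP[lj _].
  have Kj : (K < j)%N by rewrite mulSn in ik; lia.
  have := descent _ Kj; lra.
have := sum_window_le R (fun l => w l ^+ 2) K (k - i * K) k
  (fun=> sqr_ge0 _) (_ : K <= k - i * K)%N.
rewrite mulSn in ik.
have -> : (k - i * K - K = k - i.+1 * K)%N by rewrite mulSn; lia.
move=> /(_ ltac:(lia)) win.
have E : \sum_(k - i * K <= j < k) (w j ^+ 2 / (2 * eta)) = S k i / (2 * eta).
  by rewrite /S mulr_suml.
rewrite tele big_split/= sumrN E -mulr_sumr in le.
have := ler_wpM2l (_ : 0 <= L / 2) win.
rewrite divr_ge0// => /(_ isT).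
rewrite -/(S k i.+1); lra.
Qed.

(** Induction on [a], which is one less than the theorem's [a]. The weights are chosen so that
    [eps a.+1 / (2 * eta) = K * L / 2 * eps a]: the energy left at one stage is exactly what
    [window_energy_le], scaled by the next weight, replaces. *)
Lemma delayed_recursion k a : (0 < a)%N -> (a.+1 * K < k)%N ->
  c * f k.+1 <= f k + L * S k 1 ->
  c * f k.+1 <= (1 - \sum_(1 <= i < a.+1) eps i) * f k
    + \sum_(1 <= i < a.+1) eps i * f (k - i * K)%N
    + K%:R * L / 2 * eps a * S k a.+1.
Proof.
move=> a0 ak base.
have eps0 i : 0 <= eps i.
  by rewrite /eps !mulr_ge0// ?exprn_ge0// ?mulr_ge0// ltW.
elim: a a0 ak => // -[|a] IH _ ak.
  rewrite !big_nat1.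
  have := ler_wpM2l (eps0 1%N) (window_energy_le _ _ ak).
  have -> : eps 1%N * (S k 1 / (2 * eta)) = L * S k 1.
    rewrite /eps expr0; field; exact: lt0r_neq0.
  lra.
have ak' : (a.+2 * K < k)%N by apply: leq_ltn_trans ak; rewrite leq_mul2r leqnSn orbT.
have {IH} := IH isT ak'.
rewrite ![\sum_(1 <= i < a.+3) _]big_nat_recr//=.
have := ler_wpM2l (eps0 a.+2) (window_energy_le _ _ ak).
have -> : eps a.+2 * (S k a.+2 / (2 * eta)) = K%:R * L / 2 * eps a.+1 * S k a.+2.
  rewrite /eps !subSS !subn0 exprS; field; exact: lt0r_neq0.
lra.
Qed.

End DelayedRecursion.

(** * Euclidean geometry, and gradients along lines *)

Section Euclid.
Context {R : realType} {n : nat}.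
Implicit Types u v w : 'rV[R]_n.

Lemma dotvC u v : dotv u v = dotv v u.
Proof. by apply: eq_bigr => i _; rewrite mulrC. Qed.

Lemma dotvDl u v w : dotv (u + v) w = dotv u w + dotv v w.
Proof. by rewrite -big_split; apply: eq_bigr => i _; rewrite mxE mulrDl. Qed.

Lemma dotvZl c u v : dotv (c *: u) v = c * dotv u v.
Proof. by rewrite mulr_sumr; apply: eq_bigr => i _; rewrite mxE mulrA. Qed.

Lemma dotvNl u v : dotv (- u) v = - dotv u v.
Proof. by rewrite -scaleN1r dotvZl mulN1r. Qed.

Lemma dotvDr u v w : dotv u (v + w) = dotv u v + dotv u w.
Proof. by rewrite !(dotvC u) dotvDl. Qed.

Lemma dotvZr c u v : dotv u (c *: v) = c * dotv u v.
Proof. by rewrite !(dotvC u) dotvZl. Qed.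

Lemma dotvNr u v : dotv u (- v) = - dotv u v.
Proof. by rewrite !(dotvC u) dotvNl. Qed.

Lemma dotv_suml (I : Type) (s : seq I) (P : pred I) (h : I -> 'rV[R]_n) v :
  dotv (\sum_(i <- s | P i) h i) v = \sum_(i <- s | P i) dotv (h i) v.
Proof.
elim/big_rec2: _ => [|i y x _ <-]; last by rewrite dotvDl.
by rewrite -(scale0r 0) dotvZl mul0r.
Qed.

Definition dotvE := (dotvDl, dotvDr, dotvNl, dotvNr, dotvZl, dotvZr).

Lemma dotvv_ge0 u : 0 <= dotv u u.
Proof. by apply: sumr_ge0 => i _; rewrite -expr2 sqr_ge0. Qed.

Lemma enorm_ge0 u : 0 <= enorm u. Proof. exact: sqrtr_ge0. Qed.

Lemma sqr_enorm u : enorm u ^+ 2 = dotv u u.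
Proof. by rewrite sqr_sqrtr// dotvv_ge0. Qed.

Lemma enormZ c u : enorm (c *: u) = `|c| * enorm u.
Proof. by rewrite /enorm !dotvE mulrA -expr2 sqrtrM ?sqr_ge0// sqrtr_sqr. Qed.

Lemma enormN u : enorm (- u) = enorm u.
Proof. by rewrite -scaleN1r enormZ normrN1 mul1r. Qed.

Lemma enorm0 : enorm (0 : 'rV[R]_n) = 0.
Proof. by rewrite -(scale0r 0) enormZ normr0 mul0r. Qed.

(** Cauchy-Schwarz, from the nonnegative squared norm of [dotv v v *: u - dotv u v *: v], which is
    [dotv v v] times the Gram determinant. *)
Lemma dotv_le u v : dotv u v <= enorm u * enorm v.
Proof.
apply: le_trans (ler_norm _) _; rewrite -sqrtr_sqr /enorm -sqrtrM ?dotvv_ge0//.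
apply: ler_wsqrtr.
have [vv0|] := eqVneq (dotv v v) 0.
  rewrite (_ : dotv u v = 0) ?expr0n ?mulr_ge0 ?dotvv_ge0//.
  apply: big1 => i _; move/eqP: vv0; rewrite psumr_eq0 => [|j _]; last first.
    by rewrite -expr2 sqr_ge0.
  by move/allP/(_ i (mem_index_enum _)); rewrite mulf_eq0 orbb => /eqP ->; rewrite mulr0.
move=> vv; have vv0 : 0 < dotv v v by rewrite lt_def vv dotvv_ge0.
have := dotvv_ge0 (dotv v v *: u - dotv u v *: v).
rewrite !dotvE (dotvC v u) => H.
have {H} : 0 <= dotv v v * (dotv u u * dotv v v - dotv u v ^+ 2) by lra.
by rewrite pmulr_rge0// subr_ge0.
Qed.

Lemma enormD u v : enorm (u + v) <= enorm u + enorm v.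
Proof.
rewrite -(@ler_pXn2r _ 2)// ?nnegrE ?addr_ge0 ?enorm_ge0//.
rewrite sqrrD !sqr_enorm !dotvE (dotvC v u).
have := dotv_le u v; lra.
Qed.

Lemma enorm_sum (I : Type) (s : seq I) (P : pred I) (h : I -> 'rV[R]_n) :
  enorm (\sum_(i <- s | P i) h i) <= \sum_(i <- s | P i) enorm (h i).
Proof.
elim/big_rec2: _ => [|i y x _ IH]; first by rewrite enorm0.
by apply: le_trans (enormD _ _) _; rewrite lerD2l.
Qed.

Lemma enorm_path (x : nat -> 'rV[R]_n) (p q : nat) : (p <= q)%N ->
  enorm (x p - x q) <= \sum_(p <= j < q) enorm (x j.+1 - x j).
Proof.
move=> pq; rewrite -opprB enormN -telescope_sumr//; exact: enorm_sum.
Qed.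

Lemma is_derive_line (f : 'rV[R]_n -> R) g (x v : 'rV[R]_n) (t : R) :
  has_gradient f g ->
  is_derive t 1 (fun s : R => f (x + s *: v)) (dotv (g (x + t *: v)) v).
Proof.
move=> /(_ (x + t *: v)) [df fE].
pose l := fun s : R => x + s *: v.
have dl : is_diff (t : R) l (fun s : R => 0 + s *: v).
  exact: is_diffD.
have dfl : differentiable (f \o l) t by apply: differentiable_comp.
apply: DeriveDef; first exact/derivable1_diffP.
have -> := @deriveE R R R _ t (1 : R) dfl.
rewrite diff_comp//= diff_val add0r scale1r; exact: fE.
Qed.

Lemma has_gradient_avg (m : nat) (c : R) (f : 'I_m -> 'rV[R]_n -> R) g :
  (forall i, has_gradient (f i) (g i)) ->
  has_gradient (fun z => c * \sum_(i < m) f i z)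
               (fun z => c *: \sum_(i < m) g i z).
Proof.
move=> fg z.
have dS : differentiable (\sum_(i < m) f i) z.
  by apply: differentiable_sum => i; have [] := fg i z.
have -> : (fun z => c * \sum_(i < m) f i z) = c *: \sum_(i < m) f i.
  by rewrite fct_sumE; apply/funext.
split=> [|h]; first exact: differentiableZ.
rewrite diffZ//= dotvE dotv_suml -deriveE//; congr (_ * _).
have dfi i : is_derive z h (f i) (dotv (g i z) h).
  have [df dE] := fg i z.
  by apply: DeriveDef; [exact: diff_derivable|rewrite deriveE].
exact: derive_val.
Qed.

(** On the segment from [x] to [y], [f] minus its quadratic upper model has derivative at most 0, by
    Cauchy-Schwarz and the Lipschitz bound, so it does not increase from 0 to 1. *)
Lemma descent_lemma (f : 'rV[R]_n -> R) g L (x y : 'rV[R]_n) :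
  has_gradient f g -> lipschitz_grad g L ->
  f y <= f x + dotv (g x) (y - x) + L / 2 * enorm (y - x) ^+ 2.
Proof.
move=> fg gL; set v := y - x.
pose phi (t : R) := f (x + t *: v) - (t * dotv (g x) v + L / 2 * enorm v ^+ 2 * t ^+ 2).
have dphi (t : R) : is_derive t 1 phi
    (dotv (g (x + t *: v)) v - (dotv (g x) v + L * enorm v ^+ 2 * t)).
  have dl := is_derive_line f g x v t fg.
  have dq : is_derive t 1 (fun t : R => t * dotv (g x) v + L / 2 * enorm v ^+ 2 * t ^+ 2)
      (dotv (g x) v + L * enorm v ^+ 2 * t).
    apply: is_derive_eq.
    by rewrite /GRing.scale/=; field.
  exact: is_deriveB.
have : phi 1 <= phi 0.
  apply: (@ler0_derive1_le_cc R phi 0 1); rewrite ?in_itv/= ?lexx ?ler01//.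
  - move=> t; rewrite in_itv/= => /andP[t0 _].
    rewrite derive1E (@derive_val _ _ _ _ _ _ _ (dphi t)).
    rewrite opprD addrA subr_le0 -dotvNl -dotvDl.
    apply: le_trans (dotv_le _ _) _.
    apply: le_trans (ler_wpM2r (enorm_ge0 _) (gL _ _)) _.
    by rewrite addrAC subrr add0r enormZ gtr0_norm// expr2; lra.
  - by apply: derivable_within_continuous => t _; exact: ex_derive.
rewrite /phi scale1r scale0r addr0 subrKC; lra.
Qed.

(** Convexity on the segment bounds the difference quotient of [f] at [x] by an affine function of
    [t]; both sides are then passed to the limit as [t] decreases to 0. *)
Lemma strongly_convex_gradient (f : 'rV[R]_n -> R) g mu (x y : 'rV[R]_n) :
  has_gradient f g -> strongly_convex f mu ->
  f x + dotv (g x) (y - x) + mu / 2 * enorm (y - x) ^+ 2 <= f y.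
Proof.
move=> fg fmu; set v := y - x.
have quot (t : R) : 0 < t < 1 ->
    t^-1 * (f (x + t *: v) - f x) <= f y - f x - (1 - t) * (mu / 2 * enorm v ^+ 2).
  move=> /andP[t0 t1].
  have t01 : 0 <= t <= 1 by rewrite !ltW.
  have /= := fmu y x t t01.
  have -> : t *: y + (1 - t) *: x = x + t *: v.
    by rewrite /v scalerBr scalerBl scale1r addrCA.
  rewrite ler_pdivrMl// !sqr_enorm /v !dotvE (dotvC y x).
  lra.
have dl := is_derive_line f g x v 0 fg.
have cvgl : (t^-1 * (f (x + t *: v) - f x) @[t --> (0:R)^'+] --> dotv (g x) v)%classic.
  pose F (s : R) := f (x + s *: v).
  have : (h^-1 *: ((F \o shift 0) (h *: (1:R)) - F 0) @[h --> (0:R)^'] --> 'D_1 F (0:R))%classic.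
    exact: ex_derive.
  rewrite (@derive_val _ _ _ _ _ _ _ dl) scale0r addr0 => /cvg_dnbhs_at_right.
  apply: cvg_trans; apply: near_eq_cvg; near=> t.
  by rewrite /F /= addr0 scale0r addr0 [t%:A]mulr1.
have cvgr : (f y - f x - (1 - t) * (mu / 2 * enorm v ^+ 2) @[t --> (0:R)^'+] -->
    f y - f x - (1 - 0) * (mu / 2 * enorm v ^+ 2))%classic.
  apply: cvg_at_right_filter.
  apply: cvgB; first exact: cvg_cst.
  by apply: cvgMl; apply: cvgB; [exact: cvg_cst|exact: cvg_id].
suff : dotv (g x) v <= f y - f x - (1 - 0) * (mu / 2 * enorm v ^+ 2).
  rewrite subr0 mul1r; lra.
apply: ler_cvg_to cvgl cvgr _.
near=> t; apply: quot; apply/andP; split; near: t.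
  exact: nbhs_right_gt.
exact: nbhs_right_lt.
Unshelve. all: by end_near.
Qed.

End Euclid.

(** * Inequalities for one proximal step *)

Section Prox.
Context {R : realType} {n : nat}.

Lemma le_of_le_add_small (A B M : R) : 0 <= M ->
  (forall t, 0 < t < 1 -> A <= B + t * M) -> A <= B.
Proof.
move=> M0 H; rewrite leNgt; apply/negP => BA.
(* With this [t], [t * M = (A - B) / 2 - t * (A - B)], strictly below [A - B]. *)
pose t := (A - B) / (2 * (M + (A - B))).
have den : 0 < 2 * (M + (A - B)) by lra.
have tE : t * (2 * (M + (A - B))) = A - B by rewrite divfK ?lt0r_neq0.
have t01 : 0 < t < 1.
  by rewrite divr_gt0 ?subr_gt0//= ltr_pdivrMr//; lra.
have := H t t01.
have : 0 < t * (A - B) by rewrite mulr_gt0 ?subr_gt0//; case/andP: t01.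
lra.
Qed.

(** An infinite [r p] would make the prox objective at [p] exceed its finite value at a point of the
    domain. *)
Lemma prox_fin_num (r : 'rV[R]_n -> \bar R) eta y p :
  proper_fun r -> 0 < eta -> is_prox r eta y p -> r p \is a fin_num.
Proof.
move=> [rN [z rz]] eta0 /(_ z); have zfin : r z \is a fin_num.
  by rewrite fin_numE rN rz.
rewrite fin_numE rN /=; apply: contraTN => /eqP ->.
by rewrite -(fineK zfin) gt0_muley ?lte_fin// -EFinM -EFinD addey// leye_eq.
Qed.

(** First-order optimality: [eta^-1 *: (y - p)] is a subgradient of [r] at [p]. Minimality is tested
    at [t *: z + (1 - t) *: p]; after division by [t], the quadratic remainder is linear in [t] and
    vanishes in the limit. *)
Lemma prox_subgradient (r : 'rV[R]_n -> \bar R) eta y p z :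
  proper_fun r -> convex_efun r -> 0 < eta -> is_prox r eta y p ->
  r z \is a fin_num ->
  fine (r p) <= fine (r z) + eta^-1 * dotv (p - y) (z - p).
Proof.
move=> rP rC eta0 pP zfin; have pfin := prox_fin_num _ _ _ _ rP eta0 pP.
rewrite -lerBlDl mulrC ler_pdivlMr//.
apply: (@le_of_le_add_small _ _ (2^-1 * dotv (z - p) (z - p))) => [|t t01].
  by rewrite mulr_ge0 ?dotvv_ge0// invr_ge0.
set q := t *: z + (1 - t) *: p.
have := rC z p t t01; rewrite -/q -(fineK zfin) -(fineK pfin) -!EFinM -EFinD => rq.
have qfin : r q \is a fin_num.
  rewrite fin_numE rP.1 /=; apply: contraTN rq => /eqP ->.
  by rewrite leye_eq.
move: rq (pP q); rewrite -(fineK qfin) -(fineK pfin) -!EFinM -!EFinD !lee_fin => rq.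
have -> : q - y = (p - y) + t *: (z - p).
  by apply/rowP => j; rewrite !mxE; ring.
rewrite !sqr_enorm; move: (p - y) (z - p) => u v.
rewrite !dotvE (dotvC v u) => H.
case/andP: t01 => t0 t1.
have := ler_wpM2l (ltW eta0) rq => {}rq.
rewrite -(ler_pM2l t0); lra.
Qed.

(** Adding the two upper bounds cancels the gradients up to the error [G x - g], which
    Cauchy-Schwarz controls by [L * W]. *)
Lemma prox_step_descent (f : 'rV[R]_n -> R) G (L eta W rx rx' : R) (x x' g : 'rV[R]_n) :
  eta != 0 ->
  f x' <= f x + dotv (G x) (x' - x) + L / 2 * enorm (x' - x) ^+ 2 ->
  rx' <= rx + eta^-1 * dotv (x' - (x - eta *: g)) (x - x') ->
  enorm (g - G x) <= L * W ->
  f x' + rx' <= f x + rx - (eta^-1 - L / 2) * enorm (x' - x) ^+ 2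
                + L * (W * enorm (x' - x)).
Proof.
move=> eta0; rewrite opprB addrCA (addrC (eta *: g)) -(opprB x' x).
move: (x' - x) => v fx' rx'E gG.
have := le_trans (dotv_le (G x - g) v) (ler_wpM2r (enorm_ge0 v) (_ : _ <= L * W)).
rewrite -opprB enormN => /(_ gG).
move: rx'E; rewrite !dotvE -sqr_enorm.
rewrite mulrDr mulKf//; lra.
Qed.

(** The vector [G x' - g - eta^-1 *: (x' - x)] is a subgradient of [f + r] at [x'], of norm at most
    [B]. Maximizing [B * s - mu / 2 * s ^+ 2] over the distance [s] gives [B ^+ 2 / (2 * mu)]. *)
Lemma prox_step_gap (f : 'rV[R]_n -> R) G (L mu eta W rx' rs : R) (x x' s g : 'rV[R]_n) :
  0 < eta -> 0 < mu ->
  f x' + dotv (G x') (s - x') + mu / 2 * enorm (s - x') ^+ 2 <= f s ->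
  rx' <= rs + eta^-1 * dotv (x' - (x - eta *: g)) (s - x') ->
  enorm (g - G x') <= L * W ->
  2 * mu * (f x' + rx' - (f s + rs)) <= (L * W + eta^-1 * enorm (x' - x)) ^+ 2.
Proof.
move=> eta0 mu0; rewrite opprB addrCA (addrC (eta *: g)).
move: (x' - x) (s - x') => v u fx' rx'E gG.
set B := L * W + _.
have nB : enorm (g - G x' + eta^-1 *: v) <= B.
  apply: le_trans (enormD _ _) _; apply: lerD => //.
  by rewrite enormZ gtr0_norm ?invr_gt0.
have := le_trans (dotv_le _ u) (ler_wpM2r (enorm_ge0 u) nB).
move: rx'E fx'; rewrite !dotvE mulrDr mulKf ?lt0r_neq0// => h1 h2 h3.
have h : f x' + rx' - (f s + rs) <= B * enorm u - mu / 2 * enorm u ^+ 2 by lra.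
have mu20 : 0 <= 2 * mu by lra.
have := ler_wpM2l mu20 h.
have := sqr_ge0 (B - mu * enorm u); lra.
Qed.

End Prox.

(** * Application to the PIAG iterates *)

Theorem theorem1 (R : realType) (m n : nat) (hm : (1 <= m)%N)
  (fi : 'I_m -> 'rV[R]_n -> R) (gradf : 'I_m -> 'rV[R]_n -> 'rV[R]_n)
  (Li : 'I_m -> R) (mu : R) (r : 'rV[R]_n -> \bar R) (xs : 'rV[R]_n)
  (K : nat) (eta : R) (x : nat -> 'rV[R]_n) (tau : 'I_m -> nat -> nat) (a : nat) :
  let f := fun z => (m%:R)^-1 * \sum_(i < m) fi i z in
  let L := (m%:R)^-1 * \sum_(i < m) Li i in
  let F := fun z => ((f z)%:E + r z)%E in
  let g := fun k => (m%:R)^-1 *: \sum_(i < m) gradf i (x (tau i k)) in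
  let d := fun k => eta^-1 *: (x k.+1 - x k) in
  let Fk := fun k => (F (x k) - F xs)%E in
  let eps := fun i : nat => 2 * eta * L * (eta * K%:R * L) ^+ (i - 1) in
  (forall i, has_gradient (fi i) (gradf i)) ->
  (forall i, 0 <= Li i) ->
  (forall i, lipschitz_grad (gradf i) (Li i)) ->
  0 < mu -> strongly_convex f mu ->
  proper_fun r -> closed_fun r -> convex_efun r ->
  (forall z, (F xs <= F z)%E) ->
  (forall i k, (k - K <= tau i k <= k)%N) ->
  (forall k, is_prox r eta (x k - eta *: g k) (x k.+1)) ->
  0 < eta -> eta <= (L * (K.+1)%:R)^-1 ->
  (2 <= a)%N ->
  forall k, (a * K + 1 <= k)%N ->
    ((1 + eta * mu / 8)%:E * Fk k.+1 <=
     (1 - \sum_(1 <= i < a) eps i)%:E * Fk k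
     + \sum_(1 <= i < a) (eps i)%:E * Fk (k - i * K)%N
     + (eta ^+ 2 * (K%:R * L / 2) * eps (a - 1)%N
        * \sum_(k - a * K <= j < k) enorm (d j) ^+ 2)%:E)%E.
Proof.
move=> f L F g d Fk eps fG Li0 gL mu0 fmu rP _ rC Fmin tauP xP eta0 etaL a2 k ak.
pose G z := (m%:R)^-1 *: \sum_(i < m) gradf i z.
have m0 : 0 < (m%:R : R)^-1 by rewrite invr_gt0 ltr0n.
have L0 : 0 <= L by apply: mulr_ge0; [exact: ltW|exact: sumr_ge0].
(* As [0^-1 = 0], the bounds [0 < eta <= (L * K.+1)^-1] exclude [L = 0], so inverting is
   legitimate. *)
have LK : L * (K.+1)%:R <= eta^-1.
  rewrite -[leLHS]invrK lef_pV2// posrE.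
  exact: lt_le_trans etaL.
have fgG : has_gradient f G by exact: has_gradient_avg.
(* The points [y i] may differ: a constant family gives the Lipschitz bound for [G], delayed
   iterates give the error of [g]. *)
have lipavg (y : 'I_m -> 'rV[R]_n) z M : (forall i, enorm (y i - z) <= M) ->
    enorm ((m%:R)^-1 *: \sum_(i < m) gradf i (y i) - G z) <= L * M.
  move=> yM; rewrite -scalerBr -sumrB enormZ gtr0_norm// /L -mulrA.
  rewrite ler_pM2l// mulr_suml; apply: le_trans (enorm_sum _ _ _ _) _.
  apply: ler_sum => i _; apply: le_trans (gL _ _ _) _.
  exact: ler_wpM2l.
have GL : lipschitz_grad G L.
  by move=> y z; apply: lipavg.
pose w j := enorm (x j.+1 - x j).
have w0 j : 0 <= w j by exact: enorm_ge0.
(* Used with [q = j] for descent and with [q = j.+1] for the optimality gap. *)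
have gG j q : (j <= q)%N -> enorm (g j - G (x q)) <= L * \sum_(j - K <= l < q) w l.
  move=> jq; apply: lipavg => i; have /andP[t1 t2] := tauP i j.
  apply: le_trans (enorm_path _ _ _ (leq_trans t2 jq)) _.
  rewrite [leRHS](big_cat_nat t1 (leq_trans t2 jq)) lerDr.
  by apply: sumr_ge0.
(* [r (x 0)] may be +oo, but the indices involved are all at least 1. *)
have xfin j : (0 < j)%N -> r (x j) \is a fin_num.
  by case: j => // j _; exact: prox_fin_num (xP j).
have sfin : r xs \is a fin_num.
  rewrite fin_numE rP.1 /=; have := Fmin (x 1%N).
  apply: contraTN => /eqP; rewrite /F => ->.
  by rewrite -(fineK (xfin 1%N isT)) -EFinD addey// leye_eq.
pose phi j := f (x j) + fine (r (x j)) - (f xs + fine (r xs)).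
have FkE j : (0 < j)%N -> Fk j = (phi j)%:E.
  by move=> j0; rewrite /Fk /F -(fineK (xfin j j0)) -(fineK sfin).
(* Young turns the delay error into [L / 2] times the window energy plus [L * K / 2 * w j ^+ 2]. The
   coefficient of [w j ^+ 2] becomes [- eta^-1 + L * K.+1 / 2], at most [- eta^-1 / 2] by [LK]. *)
have descent j : (K < j)%N ->
    phi j.+1 <= phi j - w j ^+ 2 / (2 * eta) + L / 2 * \sum_(j - K <= l < j) w l ^+ 2.
  move=> Kj; have j0 : (0 < j)%N by apply: leq_ltn_trans Kj.
  have := prox_step_descent f G L eta _ _ _ (x j) (x j.+1) (g j) (lt0r_neq0 eta0)
    (descent_lemma _ _ _ _ _ fgG GL) (prox_subgradient _ _ _ _ _ rP rC eta0 (xP j) (xfin j j0))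
    (gG j j (leqnn j)).
  rewrite -/(w j) => step.
  have jK : (j - (j - K) <= K)%N by rewrite subKn// ltnW.
  have := ler_wpM2l L0 (sum_mul_le _ w (w j) _ _ _ jK).
  have := ler_wpM2r (sqr_ge0 (w j)) LK.
  rewrite -natr1 invfM /phi; lra.
have base : (1 + eta * mu / 8) * phi k.+1 <= phi k + L * \sum_(k - 1 * K <= l < k) w l ^+ 2.
  rewrite mul1n.
  have Kk : (K < k)%N by nia.
  have := prox_step_gap f G L mu eta _ _ _ (x k) (x k.+1) xs (g k) eta0 mu0
    (strongly_convex_gradient _ _ _ _ _ fgG fmu)
    (prox_subgradient _ _ _ _ _ rP rC eta0 (xP k) sfin)
    (gG k k.+1 (leqnSn k)).
  rewrite -/(w k) -/(phi k.+1) => gap.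
  (* Including [w k], the window has [K.+1] terms, the factor that [LK] trades for [eta^-1]. *)
  have := sqr_sum_le _ w (k - K) k.+1.
  have -> : (k.+1 - (k - K) = K.+1)%N by lia.
  rewrite ![\sum_(k - K <= _ < k.+1) _]big_nat_recr ?leq_subr//= in gap *.
  set W := \sum_(k - K <= j < k) w j + w k in gap *.
  set S := \sum_(k - K <= l < k) _ => W2.
  have S0 : 0 <= S by apply: sumr_ge0 => j _; exact: sqr_ge0.
  have := descent k Kk; rewrite -/S => step.
  have L20 : 0 <= L ^+ 2 by exact: sqr_ge0.
  have LW : (L * W) ^+ 2 <= L * eta^-1 * (S + w k ^+ 2).
    have := ler_wpM2l L20 W2.
    have T0 : 0 <= L * (S + w k ^+ 2) by rewrite mulr_ge0// addr_ge0// sqr_ge0.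
    have := ler_wpM2r T0 LK; lra.
  have gap' : eta * mu * phi k.+1 <= L * (S + w k ^+ 2) + eta^-1 * w k ^+ 2.
    have := sqr_ge0 (L * W - eta^-1 * w k) => sq.
    have : 2 * mu * phi k.+1 <= 2 * (L * eta^-1 * (S + w k ^+ 2)) + 2 * (eta^-1 * w k) ^+ 2 by lra.
    move/(ler_wpM2l (ltW eta0)).
    have -> : eta * (2 * (L / eta * (S + w k ^+ 2)) + 2 * (eta^-1 * w k) ^+ 2) =
      2 * (L * (S + w k ^+ 2) + eta^-1 * w k ^+ 2).
      by field; exact: lt0r_neq0.
    lra.
  have LS0 : 0 <= L * S by exact: mulr_ge0.
  have K1 : L <= eta^-1.
    by apply: le_trans LK; rewrite ler_peMr// ler1n.
  have := ler_wpM2r (sqr_ge0 (w k)) K1.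
  have e0 : 0 <= eta^-1 * w k ^+ 2 by rewrite mulr_ge0 ?sqr_ge0// invr_ge0 ltW.
  (* An eighth of [gap'] is added to [step]. With [L <= eta^-1], the coefficient of [w k ^+ 2 / eta]
     is at most [-1/2 + 1/8 + 1/8 < 0], and that of [L * S] is [1/2 + 1/8 <= 1]. *)
  move: step; rewrite invfM; lra.
case: a a2 ak => // a a1 ak.
have ak' : (a.+1 * K < k)%N by rewrite addn1 in ak.
have dE : \sum_(k - a.+1 * K <= j < k) enorm (d j) ^+ 2 =
    eta^-1 ^+ 2 * \sum_(k - a.+1 * K <= l < k) w l ^+ 2.
  rewrite mulr_sumr; apply: eq_bigr => j _.
  by rewrite /d enormZ exprMn gtr0_norm ?invr_gt0.
(* All indices that occur are positive, so every [Fk] is finite and the claim becomes one about the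
   reals [phi]. *)
have kpos i : (i <= a)%N -> (0 < k - i * K)%N.
  by move=> ia; rewrite subn_gt0; apply: leq_ltn_trans ak'; rewrite leq_mul2r (leqW ia) orbT.
rewrite !FkE//; last exact: leq_ltn_trans ak'.
rewrite [X in (_ <= _ + X + _)%E](_ : _ = (\sum_(1 <= i < a.+1) eps i * phi (k - i * K)%N)%:E); last first.
  rewrite -sumEFin; apply: eq_big_nat => i /andP[_ ia].
  by rewrite FkE ?kpos// EFinM.
rewrite -!EFinM -!EFinD lee_fin subn1 dE.
apply: le_trans (delayed_recursion phi w K L eta _ eta0 L0 descent k a a1 ak' base) _.
rewrite lerD2l le_eqVlt; apply/orP; left; apply/eqP.
by rewrite -/(eps a); field; exact: lt0r_neq0.
Qed.
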